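(* Let $\mathcal M$ satisfy Assumptions (A), (RE) and (I). Suppose that the distributions $\{\mu_s\}_{s\in\mathcal S}$ are absolutely continuous with respect to Lebesgue measure on $\mathbb R^d$ and have finite second-order moments. If, for some $s,s'\in\mathcal S$, the structural counterfactual operator $T^*_{\langle s'|s\rangle}$ coincides ($\mu_s$-a.e.) with the gradient of a convex function $\phi:\mathbb R^d\to\mathbb R$, then $T^*_{\langle s'|s\rangle}$ is the ($\mu_s$-a.e. unique) solution of $$\min_{T:\ T_\sharp\mu_s=\mu_{s'}}\int_{\mathcal X_s}\|x-T(x)\|^2\,\mathrm d\mu_s(x).$$
   Context: Let $(\Omega,\mathcal A,\mathbb P)$ be a probability space. A structural causal model (SCM) $\mathcal M=\langle U,G\rangle$ consists of two disjoint finite index sets $\mathcal I$ (endogenous) and $\mathcal J$ (exogenous), measurable product spaces $\mathcal V=\prod_{i\in\mathcal I}\mathcal V_i\subseteq\mathbb R^{|\mathcal I|}$ and $\mathcal U=\prod_{j\in\mathcal J}\mathcal U_j\subseteq\mathbb R^{|\mathcal J|}$, a random vector $U:\Omega\to\mathcal U$ (its components need not be independent), and for each $i\in\mathcal I$ subsets $\mathrm{Endo}(i)\subseteq\mathcal I$, $\mathrm{Exo}(i)\subseteq\mathcal J$ (endogenous and exogenous parents) and a measurable map $G_i:\mathcal V_{\mathrm{Endo}(i)}\times\mathcal U_{\mathrm{Exo}(i)}\to\mathcal V_i$. A random vector $V:\Omega\to\mathcal V$ is a solution of $\mathcal M$ if $V_i=G_i(V_{\mathrm{Endo}(i)},U_{\mathrm{Exo}(i)})$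 $\mathbb P$-a.s. for every $i\in\mathcal I$. The graph of $\mathcal M$ has nodes $\mathcal I\cup\mathcal J$ and an edge $k\to l$ iff $l\in\mathcal I$ and $k\in\mathrm{Endo}(l)\cup\mathrm{Exo}(l)$. Assumption (A): the graph of $\mathcal M$ is acyclic; then $\mathcal M$ has a solution, unique up to $\mathbb P$-null sets. For $I\subseteq\mathcal I$ and $v_I\in\mathcal V_I$, the do-intervention $\mathrm{do}(V_I=v_I)$ produces the model $\langle U,\tilde G\rangle$ with $\tilde G_i\equiv v_i$ for $i\in I$ and $\tilde G_i=G_i$ otherwise (same $U$); it is again acyclic, and its solution is denoted $V_{V_I=v_I}$. Standing setting: the solution is $V=(X,S)$ where $X:\Omega\to\mathcal X\subseteq\mathbb R^d$ and $S:\Omega\to\mathcal S$ with $\mathcal S\subset\mathbb R$ finite and $\mathbb P(S=s)>0$ for all $s\in\mathcal S$. $U_X$ denotes the vector of exogenous parents of the components of $X$, and $U_S$ that of $S$. For $s\in\mathcal S$, $X_{S=s}$ denotes the $X$-component of the solution of the model intervened by $\mathrm{do}(S=s)$. Notation: $\mu_s:=\mathcal L(X\mid S=s)$ with support $\mathcal X_s$. Under (A) there is a measurable $F$ with $X=F(S,U_X)$ a.s. and $X_{S=s}=F(s,U_X)$ a.s. for every $s$; set $f_s(u):=F(s,u)$. Assumption (I): the functions $\{f_s\}_{s\in\mathcal S}$ are injective; under (I), the structural counterfactual operator is $T^*_{\langle s'|s\rangle}:=f_{s'}\circ f_s^{-1}|_{\mathcal X_s}$. Assumption (RE): $U_S$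 is independent of $U_X$, and no component of $X$ is an endogenous parent of $S$. $T_\sharp P:=P\circ T^{-1}$. *)

(* Defs.v *)
From HB Require Import structures.
From mathcomp Require Import all_boot all_order all_algebra.
From mathcomp Require Import all_classical all_reals all_analysis.
Set Implicit Arguments.
Unset Strict Implicit.
Unset Printing Implicit Defensive.
Import Order.TTheory GRing.Theory Num.Theory.
Local Open Scope classical_set_scope.
Local Open Scope ring_scope.

(* Endogenous index set I = 'I_(d.+1): indices widen_ord i (i < d) are  *)
(* the components X_1..X_d of X, index ord_max is S.                  *)
(* Exogenous index set J = 'I_m.  Vectors in R^I, R^J are tuples,      *)
(* equipped with the product (coordinate) sigma-algebra of the library.*)

Record SCM (R : realType) (d m : nat) := MkSCM {
  Vsp  : 'I_d.+1 -> set R;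
  Usp  : 'I_m -> set R;
  Endo : 'I_d.+1 -> {set 'I_d.+1};
  Exo  : 'I_d.+1 -> {set 'I_m};
  G    : 'I_d.+1 -> (d.+1).-tuple R * m.-tuple R -> R
}.

Section SCMdefs.
Context {R : realType} {d m : nat}.
Implicit Types (M : SCM R d m).

Definition Vdom M : set ((d.+1).-tuple R) := [set v | forall i, Vsp M i (tnth v i)].
Definition Udom M : set (m.-tuple R) := [set u | forall j, Usp M j (tnth u j)].

Definition wf_SCM M : Prop :=
  [/\ (forall i, measurable (Vsp M i)),
      (forall j, measurable (Usp M j)),
      (forall i vu, Vdom M vu.1 -> Udom M vu.2 -> Vsp M i (G M i vu)),
      (forall i v v' u u',
          (forall k, k \in Endo M i -> tnth v k = tnth v' k) ->
          (forall j, j \in Exo M i -> tnth u j = tnth u' j) ->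
          G M i (v, u) = G M i (v', u')) &
      (forall i, measurable_fun (Vdom M `*` Udom M) (G M i))].

Definition scm_edge M (k l : ('I_d.+1 + 'I_m)%type) : bool :=
  match l, k with
  | inl l', inl k' => k' \in Endo M l'
  | inl l', inr j => j \in Exo M l'
  | inr _, _ => false
  end.

Definition acyclic M : Prop :=
  forall (x : ('I_d.+1 + 'I_m)%type) (p : seq ('I_d.+1 + 'I_m)%type),
    path (scm_edge M) x p -> last x p = x -> p = [::].

Definition do_S M (s : R) : SCM R d m :=
  MkSCM (Vsp M) (Usp M)
    (fun i => if i == ord_max then finset.set0 else Endo M i)
    (fun i => if i == ord_max then finset.set0 else Exo M i)
    (fun i => if i == ord_max then (fun _ => s) else G M i).

Section Solutions.
Context {dO : measure_display} {Omega : measurableType dO}.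
Variable P : probability Omega R.

Definition exo_vector M (U : Omega -> m.-tuple R) : Prop :=
  measurable_fun setT U /\ forall w, Udom M (U w).

Definition is_solution M (U : Omega -> m.-tuple R)
    (V : Omega -> (d.+1).-tuple R) : Prop :=
  [/\ measurable_fun setT V, (forall w, Vdom M (V w)) &
      forall i, {ae P, forall w, tnth (V w) i = G M i (V w, U w)}].

End Solutions.

Definition Xpart (v : (d.+1).-tuple R) : d.-tuple R :=
  [tuple tnth v (widen_ord (leqnSn d) i) | i < d].
Definition Spart (v : (d.+1).-tuple R) : R := tnth v ord_max.

Definition JX M : {set 'I_m} :=
  \bigcup_(i < d) Exo M (widen_ord (leqnSn d) i).
Definition JS M : {set 'I_m} := Exo M ord_max.

Definition depends_only_on (J : {set 'I_m}) (A : set (m.-tuple R)) : Prop :=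
  forall u u', (forall j, j \in J -> tnth u j = tnth u' j) -> (A u <-> A u').

(* Assumption (RE): U_S independent of U_X, and no component of X is an
   endogenous parent of S. Independence of the random vectors U_S and U_X
   is the product rule on their generated sigma-algebras, i.e. on the
   preimages under U of measurable cylinder sets depending only on the
   coordinates in J_S, resp. J_X. *)
Definition RE {dO : measure_display} {Omega : measurableType dO}
    (P : probability Omega R) M (U : Omega -> m.-tuple R) : Prop :=
  (forall A B : set (m.-tuple R), measurable A -> measurable B ->
     depends_only_on (JS M) A -> depends_only_on (JX M) B ->
     P (U @^-1` A `&` U @^-1` B) = (P (U @^-1` A) * P (U @^-1` B))%E) /\
  (forall i : 'I_d, widen_ord (leqnSn d) i \notin Endo M ord_max).

Definition cond_law {dO : measure_display} {Omega : measurableType dO}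
    (P : probability Omega R) (X : Omega -> d.-tuple R) (S : Omega -> R)
    (s : R) : set (d.-tuple R) -> \bar R :=
  fun A => (P (X @^-1` A `&` S @^-1` [set s]) *
            ((fine (P (S @^-1` [set s])))^-1)%:E)%E.

Definition inj_on_UX M (f : m.-tuple R -> d.-tuple R) : Prop :=
  forall u u', Udom M u -> Udom M u' -> f u = f u' ->
    forall j, j \in JX M -> tnth u j = tnth u' j.

(* T*_<s'|s> = f_{s'} o f_s^{-1} (values outside the range of f_s are
   irrelevant; they are fixed arbitrarily) *)
Definition cf_op M (F : R -> m.-tuple R -> d.-tuple R) (s s' : R)
    (x : d.-tuple R) : d.-tuple R :=
  F s' (xget [tuple 0 | _ < m] [set u | Udom M u /\ F s u = x]).

End SCMdefs.

Section Rd.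
Context {R : realType} {d : nat}.
Implicit Types (x y : d.-tuple R).

Definition tadd x y : d.-tuple R := [tuple tnth x i + tnth y i | i < d].
Definition tsub x y : d.-tuple R := [tuple tnth x i - tnth y i | i < d].
Definition tscale (t : R) x : d.-tuple R := [tuple t * tnth x i | i < d].
Definition dotp x y : R := \sum_(i < d) tnth x i * tnth y i.
Definition sqnorm x : R := dotp x x.
Definition enorm x : R := Num.sqrt (sqnorm x).

Definition convex_fun (phi : d.-tuple R -> R) : Prop :=
  forall x y (t : R), 0 <= t <= 1 ->
    phi (tadd (tscale t x) (tscale (1 - t) y)) <= t * phi x + (1 - t) * phi y.

Definition is_gradient (phi : d.-tuple R -> R) x (g : d.-tuple R) : Prop :=
  forall e : R, 0 < e -> exists2 delta : R, 0 < delta &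
    forall h, enorm h < delta ->
      `|phi (tadd x h) - phi x - dotp g h| <= e * enorm h.

Definition box (a b : d.-tuple R) : set (d.-tuple R) :=
  [set y | forall i, tnth a i <= tnth y i <= tnth b i].
Definition box_vol (a b : d.-tuple R) : R :=
  \prod_(i < d) Num.max (tnth b i - tnth a i) 0.
Definition lebesgue_null (A : set (d.-tuple R)) : Prop :=
  forall e : R, 0 < e -> exists a b : nat -> d.-tuple R,
    A `<=` \bigcup_k box (a k) (b k) /\
    (\sum_(0 <= k <oo) (box_vol (a k) (b k))%:E < e%:E)%E.

Definition abs_cont_leb (mu : set (d.-tuple R) -> \bar R) : Prop :=
  forall A, measurable A -> lebesgue_null A -> mu A = 0%E.

Definition finite_second_moment (mu : set (d.-tuple R) -> \bar R) : Prop :=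
  (\int[mu]_x (sqnorm x)%:E < +oo)%E.

(* support of mu (closed sup-norm balls generate the usual topology) *)
Definition support (mu : set (d.-tuple R) -> \bar R) : set (d.-tuple R) :=
  [set x : d.-tuple R | forall e : R, 0 < e ->
     (0 < mu [set y : d.-tuple R | forall i, (`|tnth y i - tnth x i| < e)%R])%E].

Definition pushes (T : d.-tuple R -> d.-tuple R)
    (mu nu : set (d.-tuple R) -> \bar R) : Prop :=
  forall A, measurable A -> mu (T @^-1` A) = nu A.

Definition qcost (mu : set (d.-tuple R) -> \bar R) (T : d.-tuple R -> d.-tuple R)
  : \bar R := \int[mu]_(x in support mu) (sqnorm (tsub x (T x)))%:E.

End Rd.

(* Main.v *)
Require Import Defs.
From HB Require Import structures.
From mathcomp Require Import all_boot all_order all_algebra.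
From mathcomp Require Import all_classical all_reals all_analysis.
From mathcomp Require Import measurable_realfun ring lra.
Import Order.TTheory GRing.Theory Num.Theory numFieldNormedType.Exports.
Local Open Scope classical_set_scope.
Local Open Scope ring_scope.
Set Implicit Arguments.
Unset Strict Implicit.
Unset Printing Implicit Defensive.

(** Under (RE) the law [mu_s] is the law of [F(s, U_X)], so the counterfactual
    map sends [F(s, U_X)] to [F(s', U_X)] and hence [mu_s] to [mu_s'].  A map
    that agrees almost everywhere with the gradient of a convex [phi] is
    optimal by Fenchel duality: [<x, T x> <= phi x + phi^* (T x)] for every
    competitor [T], the integral of the right-hand side depends on [T] only
    through the image measure, and equality forces [T x] to be a subgradient
    of [phi] at [x], i.e. the gradient. *)

(** * Convex functions *)

Section Convex.
Context {R : realType} {d : nat}.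
Implicit Types (x y z h v g : d.-tuple R) (phi : d.-tuple R -> R).

(** Sup-norm balls, as in [support]: they are cut out coordinate by coordinate, which suits the
    product sigma-algebra. *)
Definition supball x (e : R) : set (d.-tuple R) :=
  [set y | forall i, `|tnth y i - tnth x i| < e].

Definition sup_continuous phi := forall x (e : R), 0 < e ->
  exists2 delta : R, 0 < delta &
    forall y, supball x delta y -> `|phi y - phi x| < e.

Lemma dotpDl x y z : dotp (tadd x y) z = dotp x z + dotp y z.
Proof.
by rewrite /dotp -big_split; apply: eq_bigr => i _; rewrite tnth_mktuple mulrDl.
Qed.

Lemma dotpBl x y z : dotp (tsub x y) z = dotp x z - dotp y z.
Proof.
rewrite /dotp -sumrB; apply: eq_bigr => i _; by rewrite tnth_mktuple mulrBl.
Qed.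

Lemma dotpZl (t : R) x z : dotp (tscale t x) z = t * dotp x z.
Proof.
by rewrite /dotp mulr_sumr; apply: eq_bigr => i _; rewrite tnth_mktuple mulrA.
Qed.

Lemma dotpC x y : dotp x y = dotp y x.
Proof. by apply: eq_bigr => i _; rewrite mulrC. Qed.

Lemma sqnorm_ge0 x : 0 <= sqnorm x.
Proof. by apply: sumr_ge0 => i _; rewrite -expr2 sqr_ge0. Qed.

Lemma sqnorm_sub x y : sqnorm (tsub x y) = sqnorm x + sqnorm y - 2 * dotp x y.
Proof.
by rewrite /sqnorm dotpBl !(dotpC _ (tsub x y)) !dotpBl (dotpC y x); ring.
Qed.

Lemma sqnorm_eq0 x : sqnorm x = 0 -> forall i, tnth x i = 0.
Proof.
move=> /eqP; rewrite psumr_eq0 => [/allP x0 i|i _]; last by rewrite -expr2 sqr_ge0.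
have := x0 i (mem_index_enum i).
by rewrite mulf_eq0 orbb => /eqP.
Qed.

Lemma tsub_eq0 x y : sqnorm (tsub x y) = 0 -> x = y.
Proof.
move=> /sqnorm_eq0 xy; apply: eq_from_tnth => i; apply/eqP.
by rewrite -subr_eq0; have := xy i; rewrite tnth_mktuple => ->.
Qed.

Lemma convex_ray phi x v (t : R) : convex_fun phi -> 0 <= t <= 1 ->
  phi (tadd x (tscale t v)) - phi x <= t * (phi (tadd x v) - phi x).
Proof.
move=> cphi t01; have := cphi (tadd x v) x t t01.
have -> : tadd (tscale t (tadd x v)) (tscale (1 - t) x) = tadd x (tscale t v).
  by apply: eq_from_tnth => i; rewrite !tnth_mktuple; ring.
lra.
Qed.

Lemma convex_usc_ray phi x v (e : R) : convex_fun phi -> 0 < e ->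
  exists2 delta : R, 0 < delta & forall t, 0 <= t < delta ->
    phi (tadd x (tscale t v)) < phi x + e.
Proof.
(* The [+ 1] makes [C] positive; for [t < e / C] the chord bound is at most [t * C < e]. *)
move=> cphi e0; set C := `|phi (tadd x v) - phi x| + 1.
have C0 : 0 < C by rewrite ltr_wpDl.
exists (Num.min 1 (e / C)); first by rewrite lt_min ltr01 divr_gt0.
move=> t /andP[t0]; rewrite lt_min => /andP[t1]; rewrite ltr_pdivlMr// => tC.
have := @convex_ray phi x v t cphi; rewrite t0 (ltW t1) => /(_ isT).
have : t * (phi (tadd x v) - phi x) <= t * C.
  by rewrite ler_wpM2l// /C (le_trans (ler_norm _))// lerDl.
lra.
Qed.

Lemma convex_half phi x h v : convex_fun phi ->
  phi (tadd x (tadd h v)) <=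
    (phi (tadd x (tscale 2 h)) + phi (tadd x (tscale 2 v))) / 2.
Proof.
move=> cphi.
have := cphi (tadd x (tscale 2 h)) (tadd x (tscale 2 v)) 2^-1.
have -> : tadd (tscale 2^-1 (tadd x (tscale 2 h)))
  (tscale (1 - 2^-1) (tadd x (tscale 2 v))) = tadd x (tadd h v).
  by apply: eq_from_tnth => i; rewrite !tnth_mktuple; field.
lra.
Qed.

(** The index is a natural number to allow induction on it; the vector is zero once [k >= d]. *)
Definition dirv (k : nat) (t : R) : d.-tuple R :=
  [tuple if i == k :> nat then t else 0 | i < d].

(* One coordinate is added at a time, [x + h + v] being the midpoint of
   [x + 2h] and [x + 2v]. *)
Lemma convex_usc phi x (e : R) : convex_fun phi -> 0 < e ->
  exists2 delta : R, 0 < delta & forall h,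
    (forall i, `|tnth h i| < delta) -> phi (tadd x h) < phi x + e.
Proof.
move=> cphi e0.
(* Induction on the number [k] of leading coordinates allowed to be nonzero. *)
suff H k : exists2 delta : R, 0 < delta & forall h,
    (forall i, `|tnth h i| < delta) ->
    (forall i : 'I_d, (k <= i)%N -> tnth h i = 0) -> phi (tadd x h) < phi x + e.
  have [delta delta0 Hd] := H d; exists delta => // h hd.
  by apply: Hd => // i; rewrite leqNgt ltn_ord.
elim: k => [|k [delta delta0 IH]].
  exists 1 => // h _ h0.
  have -> : tadd x h = x.
    by apply: eq_from_tnth => i; rewrite tnth_mktuple h0// addr0.
  lra.
have [d1 d10 H1] := @convex_usc_ray phi x (dirv k 1) e cphi e0.
have [d2 d20 H2] := @convex_usc_ray phi x (dirv k (-1)) e cphi e0.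
(* The halves compensate the doubling in [convex_half]. *)
exists (Num.min (delta / 2) (Num.min (d1 / 2) (d2 / 2))).
  by rewrite !lt_min !divr_gt0.
(* The sum is the [k]-th coordinate of [h], or 0 when [k >= d]. *)
move=> h hd h0; pose t := \sum_(i < d | i == k :> nat) tnth h i.
pose h' : d.-tuple R := [tuple if i == k :> nat then 0 else tnth h i | i < d].
have th (i : 'I_d) : i = k :> nat -> t = tnth h i.
  move=> ik; rewrite /t (bigD1 i) ?ik//= big1 ?addr0// => j /andP[/eqP jk].
  by move/negP; case; apply/eqP/val_inj; rewrite /= jk.
have -> : tadd x h = tadd x (tadd h' (dirv k t)).
  apply: eq_from_tnth => i; rewrite !tnth_mktuple.
  by case: eqP => [/th ->|_]; ring.
apply: le_lt_trans (convex_half _ _ _ cphi) _.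
have A : phi (tadd x (tscale 2 h')) < phi x + e.
  apply: IH => i; rewrite !tnth_mktuple.
    case: ifP => _; first by rewrite mulr0 normr0.
    have := hd i; rewrite !lt_min => /andP[+ _].
    by rewrite normrM ger0_norm//; lra.
  move=> ki; case: ifP => [_|/eqP ik]; first by rewrite mulr0.
  by rewrite h0 ?mulr0// ltn_neqAle ki eq_sym andbT; apply/eqP.
have td : `|t| < Num.min (d1 / 2) (d2 / 2).
  have [kd|dk] := ltnP k d.
    rewrite (@th (Ordinal kd))//.
    by have := hd (Ordinal kd); rewrite lt_min => /andP[].
  rewrite /t big1 ?normr0 ?lt_min ?divr_gt0// => i /eqP ik.
  by move: (ltn_ord i); rewrite ik ltnNge dk.
move: td; rewrite lt_min => /andP[td1 td2].
have B : phi (tadd x (tscale 2 (dirv k t))) < phi x + e.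
  have [t0|t0] := leP 0 t.
    have -> : tscale 2 (dirv k t) = tscale (2 * t) (dirv k 1).
      apply: eq_from_tnth => i; rewrite !tnth_mktuple.
      by case: ifP => _; ring.
    apply: H1; move: td1; rewrite ger0_norm//; lra.
  have -> : tscale 2 (dirv k t) = tscale (2 * - t) (dirv k (-1)).
    apply: eq_from_tnth => i; rewrite !tnth_mktuple.
    by case: ifP => _; ring.
  apply: H2; move: td2; rewrite ltr0_norm//; lra.
lra.
Qed.

(** Upper bounds near [x] suffice: [x] is the midpoint of [y] and its reflection [2x - y], so an
    upper bound at the reflection is a lower bound at [y]. *)
Lemma convex_sup_continuous phi : convex_fun phi -> sup_continuous phi.
Proof.
move=> cphi x e e0; have [delta delta0 H] := convex_usc x cphi e0.
exists delta => // y xy.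
have yE : y = tadd x (tsub y x).
  by apply: eq_from_tnth => i; rewrite !tnth_mktuple; ring.
have up : phi y < phi x + e.
  by rewrite yE; apply: H => i; rewrite tnth_mktuple; exact: xy.
have lo : phi (tsub (tscale 2 x) y) < phi x + e.
  have -> : tsub (tscale 2 x) y = tadd x (tsub x y).
    by apply: eq_from_tnth => i; rewrite !tnth_mktuple; ring.
  by apply: H => i; rewrite tnth_mktuple distrC; exact: xy.
have := cphi y (tsub (tscale 2 x) y) 2^-1.
have -> : tadd (tscale 2^-1 y) (tscale (1 - 2^-1) (tsub (tscale 2 x) y)) = x.
  by apply: eq_from_tnth => i; rewrite !tnth_mktuple; field.
rewrite ltr_norml; lra.
Qed.

Lemma enorm_ge0 x : 0 <= enorm x.
Proof. exact: sqrtr_ge0. Qed.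

Lemma enormZ (t : R) x : 0 <= t -> enorm (tscale t x) = t * enorm x.
Proof.
move=> t0; rewrite /enorm /sqnorm dotpZl dotpC dotpZl mulrA -expr2.
by rewrite sqrtrM ?sqr_ge0// sqrtr_sqr ger0_norm.
Qed.

Lemma gradient_ray phi x g v (e : R) : is_gradient phi x g -> 0 < e ->
  exists2 t : R, 0 < t <= 1 &
    `|phi (tadd x (tscale t v)) - phi x - t * dotp g v| <= t * e.
Proof.
move=> gphi e0; have v1 : 0 < enorm v + 1 by rewrite ltr_wpDl ?enorm_ge0.
have [delta delta0 H] := gphi (e / (enorm v + 1)) (divr_gt0 e0 v1).
(* The [+ 1] covers [v = 0]; halving makes [t * enorm v < delta] strict. *)
pose t := Num.min 1 (delta / (enorm v + 1) / 2).
have t0 : 0 < t by rewrite lt_min ltr01 !divr_gt0.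
have t1 : t <= 1 by rewrite ge_min lexx.
have tv : t * (enorm v + 1) <= delta / 2.
  have : t <= delta / (enorm v + 1) / 2 by rewrite ge_min lexx orbT.
  by rewrite -(ler_pM2r v1) mulrAC divfK ?gt_eqF.
exists t; first by rewrite t0.
have tn : enorm (tscale t v) < delta.
  by rewrite enormZ ?(ltW t0)//; nra.
have := H _ tn; rewrite dotpC dotpZl dotpC enormZ ?(ltW t0)// => /le_trans; apply.
rewrite mulrCA ler_pM2l// mulrAC ler_pdivrMr// ler_pM2l//; lra.
Qed.

(** By convexity the difference quotients towards [z] stay below [phi z - phi x], and they
    approximate [dotp g (tsub z x)]. *)
Lemma gradient_subgradient phi x g z : convex_fun phi -> is_gradient phi x g ->
  phi x + dotp g (tsub z x) <= phi z.
Proof.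
move=> cphi gphi; apply/ler_addgt0Pr => e e0.
have [t /andP[t0 t1]] := gradient_ray (tsub z x) gphi e0.
have := @convex_ray phi x (tsub z x) t cphi; rewrite (ltW t0) t1 => /(_ isT).
have -> : tadd x (tsub z x) = z.
  by apply: eq_from_tnth => i; rewrite !tnth_mktuple; ring.
rewrite ler_norml => A /andP[B _].
have : t * dotp g (tsub z x) <= t * (phi z - phi x + e) by lra.
rewrite ler_pM2l//; lra.
Qed.

(** Testing the subgradient inequality in the direction [v - g] bounds [|v - g|^2] by every positive
    [e]. *)
Lemma subgradient_gradient phi x g v : is_gradient phi x g ->
  (forall z, phi x + dotp v (tsub z x) <= phi z) -> v = g.
Proof.
move=> gphi sub; apply: tsub_eq0; apply/eqP; rewrite eq_le sqnorm_ge0 andbT.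
apply/ler_addgt0Pr => e e0; rewrite add0r.
have [t /andP[t0 t1]] := gradient_ray (tsub v g) gphi e0.
rewrite ler_norml => /andP[_ A].
have := sub (tadd x (tscale t (tsub v g))).
have -> : tsub (tadd x (tscale t (tsub v g))) x = tscale t (tsub v g).
  by apply: eq_from_tnth => i; rewrite !tnth_mktuple; ring.
rewrite (dotpC v) dotpZl => B.
have {A B} : t * dotp (tsub v g) v - t * dotp g (tsub v g) <= t * e by lra.
by rewrite -mulrBr ler_pM2l// {1}(dotpC (tsub v g)) -dotpBl.
Qed.

End Convex.

(** * Rational balls, measurability and the support *)

Section Rational.
Context {R : realType} {d : nat}.
Implicit Types (x y : d.-tuple R) (phi : d.-tuple R -> R).

Definition rat_point (n : nat) : d.-tuple R :=
  if unpickle n is Some q then map_tuple ratr (q : d.-tuple rat)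
  else [tuple 0 | _ < d].

Lemma rat_point_dense x (e : R) : 0 < e -> exists n, supball x e (rat_point n).
Proof.
move=> e0.
have H (i : 'I_d) : exists q : rat, ratr q \in `]tnth x i - e, tnth x i + e[.
  by apply: rat_in_itvoo; lra.
pose q : d.-tuple rat := [tuple sval (cid (H i)) | i < d].
exists (pickle q) => i; rewrite /rat_point pickleK tnth_map tnth_mktuple.
by case: cid => r /=; rewrite in_itv/= ltr_distl.
Qed.

(* Lindelof's argument with rational balls, for [Pr B] meaning that [B] is
   included in a given open set, or that [B] is negligible. *)
Lemma open_property_cover (Pr : set (d.-tuple R) -> Prop) :
  (forall A B, A `<=` B -> Pr B -> Pr A) ->
  exists F : nat -> set (d.-tuple R),
    (forall n, F n = set0 \/ exists x e, F n = supball x e /\ Pr (F n)) /\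
    [set x | exists2 e : R, 0 < e & Pr (supball x e)] = \bigcup_n F n.
Proof.
move=> PrS; pose B n := if unpickle n is Some p then
  supball (rat_point p.1) (p.2.+1%:R^-1) else set0.
exists (fun n => if `[< Pr (B n) >] then B n else set0); split.
  move=> n; case: asboolP => [|_]; last by left.
  rewrite /B; case: unpickle => [[q k]|]; last by left.
  by right; exists (rat_point q), (k.+1%:R^-1).
apply/seteqP; split=> [x [e e0 Pe]|x [n _]].
  (* A ball of radius below [e / 2] that contains [x] lies in the [e]-ball around [x]. *)
  have e20 : 0 < e / 2 by rewrite divr_gt0.
  have [N _ HN] := near_infty_natSinv_lt (PosNum e20).
  have := HN N (leqnn N); rewrite [_ < _]/= => eN.
  have [q xq] : exists q, supball x N.+1%:R^-1 (rat_point q).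
    by apply: rat_point_dense; rewrite invr_gt0.
  exists (pickle (q, N)) => //; rewrite /B pickleK/=.
  case: asboolP => [_ i|]; first by rewrite distrC.
  case; apply: PrS Pe => y By i.
  have := By i; have := xq i => /=; move: (N.+1%:R^-1) eN => r.
  rewrite !ltr_norml; lra.
case: asboolP => //; rewrite /B; case: unpickle => [[q k]|]//= Pr' Bx.
suff [e e0 He] : exists2 e : R, 0 < e & supball x e `<=`
    supball (rat_point q) k.+1%:R^-1.
  by exists e => //; exact: PrS Pr'.
(* [m] is the distance from [x] to the centre; the slack between the radius and [m] is the radius of
   a ball around [x] inside the rational one. *)
pose m := \big[Num.max/0]_(i < d) `|tnth x i - tnth (rat_point q) i|.
have m1 : m < k.+1%:R^-1.
  by apply: bigmax_lt => //; rewrite invr_gt0.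
exists (k.+1%:R^-1 - m); first by rewrite subr_gt0.
move=> y xy i; have := xy i; move: (k.+1%:R^-1) => r /=.
have : `|tnth x i - tnth (rat_point q) i| <= m by exact: le_bigmax.
have := ler_distD (tnth x i) (tnth y i) (tnth (rat_point q) i); lra.
Qed.

Lemma measurable_supball x e : measurable (supball x e).
Proof.
have -> : supball x e = \bigcap_(i : 'I_d) [set y | `|tnth y i - tnth x i| < e].
  by apply/seteqP; split=> y H i => [_|]; exact: H.
apply: fin_bigcap_measurable => // i _.
rewrite -[X in measurable X]setTI.
have : measurable_fun setT (fun y : d.-tuple R => `|tnth y i - tnth x i|).
  apply: measurableT_comp => //; apply: measurable_funB => //.
  exact: measurable_tnth.
move=> /(_ measurableT `]-oo, e[%classic (measurable_itv _)).
by congr measurable; apply/seteqP; split=> y /=; rewrite in_itv.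
Qed.

Lemma measurable_sup_open (A : set (d.-tuple R)) :
  (forall x, A x -> exists2 e : R, 0 < e & supball x e `<=` A) -> measurable A.
Proof.
move=> oA; have [|F [HF AE]] := @open_property_cover (fun B => B `<=` A).
  by move=> B C BC; exact: subset_trans.
have -> : A = \bigcup_n F n.
  rewrite -AE; apply/seteqP; split=> [x /oA//|x [e e0]]; apply => i.
  by rewrite subrr normr0.
apply: bigcupT_measurable => n.
by case: (HF n) => [->//|[x [e [-> _]]]]; exact: measurable_supball.
Qed.

Lemma measurable_sup_continuous phi : sup_continuous phi ->
  measurable_fun setT phi.
Proof.
move=> cphi; apply: (measurability _ (RGenOInfty.measurableE R)) => //.
move=> _ [_ [a ->] <-]; rewrite setTI; apply: measurable_sup_open => x /=.
rewrite in_itv/= andbT => ax.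
have [e e0 He] := cphi x (phi x - a) (ltac:(by rewrite subr_gt0)).
exists e => // y /He; rewrite /= in_itv/= andbT ltr_norml; lra.
Qed.

(** Each point off the support has a null ball, and countably many null balls cover them all. This
    lets [qcost] be integrated over the whole space. *)
Lemma support_conull (mu : {measure set (d.-tuple R) -> \bar R}) :
  measurable (Defs.support mu) /\ mu (~` Defs.support mu) = 0%E.
Proof.
have [|F [HF AE]] := @open_property_cover (fun B => mu.-negligible B).
  by move=> B C BC; exact: negligibleS.
have suppE : ~` Defs.support mu = \bigcup_n F n.
  rewrite -AE; apply/seteqP; split=> x /=.
    move=> /existsNP[e] /not_implyP[e0 ne]; exists e => //.
    apply/negligibleP; first exact: measurable_supball.
    by apply/eqP; rewrite -measure_le0 leNgt; apply/negP.
  move=> [e e0 /negligibleP mu0] /(_ e e0).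
  by rewrite [X in mu X](_ : _ = supball x e)// mu0 ?ltxx//;
    exact: measurable_supball.
have mF n : measurable (F n).
  by case: (HF n) => [->//|[x [e [-> _]]]]; exact: measurable_supball.
have mS : measurable (~` Defs.support mu).
  by rewrite suppE; exact: bigcupT_measurable.
split; first by rewrite -[Defs.support mu]setCK; exact: measurableC.
apply/negligibleP => //; rewrite suppE; apply: negligible_bigcup => n.
by case: (HF n) => [->|[x [e []]]//]; exact: negligible_set0.
Qed.

End Rational.

(** * Measurability of gradients *)

Section Gradient.
Context {R : realType} {d : nat}.
Implicit Types (x y : d.-tuple R) (phi : d.-tuple R -> R).

Lemma measurable_tadd (v : d.-tuple R) :
  measurable_fun setT (fun x : d.-tuple R => tadd x v).
Proof.
apply/measurable_fun_tnthP => i.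
rewrite (_ : _ \o _ = fun x : d.-tuple R => tnth x i + tnth v i); last first.
  by apply/funext => x /=; rewrite tnth_mktuple.
by apply: measurable_funD => //; exact: measurable_tnth.
Qed.

Lemma gradient_coord phi x g (i : 'I_d) : is_gradient phi x g ->
  (n.+1%:R * (phi (tadd x (dirv i n.+1%:R^-1)) - phi x)) @[n --> \oo]
    --> tnth g i.
Proof.
move=> gphi; apply/cvgrPdist_le => e e0.
have [delta delta0 H] := gphi e e0.
have [N _ HN] := near_infty_natSinv_lt (PosNum delta0).
exists N => // n /= Nn; have := HN n Nn; rewrite [_ < _]/= => nd.
have n0 : 0 < n.+1%:R^-1 :> R by rewrite invr_gt0.
have dirE (t : R) y : dotp (dirv i t) y = t * tnth y i.
  rewrite /dotp (bigD1 i)//= tnth_mktuple eqxx big1 ?addr0// => j ji.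
  rewrite tnth_mktuple ifN ?mul0r//.
have nE : enorm (dirv i n.+1%:R^-1 : d.-tuple R) = n.+1%:R^-1.
  rewrite /enorm /sqnorm dirE tnth_mktuple eqxx -expr2 sqrtr_sqr ger0_norm//.
have := H (dirv i n.+1%:R^-1); rewrite nE => /(_ nd).
rewrite dotpC dirE distrC.
set a := phi _ - phi x => /(ler_wpM2l (ltW (ltr0Sn R n))).
rewrite mulrCA mulfV ?mulr1 ?pnatr_eq0//; apply: le_trans.
have -> : tnth g i - n.+1%:R * a = n.+1%:R * (n.+1%:R^-1 * tnth g i - a).
  by rewrite [RHS]mulrBr mulrA mulfV ?mul1r ?pnatr_eq0.
by rewrite normrM ger0_norm.
Qed.

Lemma measurable_gradient phi (D : set (d.-tuple R)) g : convex_fun phi ->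
  measurable D -> (forall x, D x -> is_gradient phi x (g x)) ->
  measurable_fun setT (patch (cst [tuple 0 | _ < d]) D g).
Proof.
move=> /convex_sup_continuous/measurable_sup_continuous mphi mD gphi.
apply/measurable_fun_tnthP => i.
(* The indicator makes the difference quotients converge off [D] too, to the patched value 0. *)
pose h n x := (\1_D x : R) *
  (n.+1%:R * (phi (tadd x (dirv i n.+1%:R^-1)) - phi x)).
apply: (@measurable_fun_cvg _ _ _ setT h).
  move=> n; apply: measurable_funM; first exact: measurable_indic.
  apply: measurable_funM => //; apply: measurable_funB => //.
  by apply: (measurableT_comp mphi); exact: measurable_tadd.
move=> x _; rewrite /h /= /patch indicE; case: ifPn => [xD|_].
  under eq_fun do rewrite mul1r.
  by apply: gradient_coord; apply: gphi; rewrite inE in xD.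
by under eq_fun do rewrite mul0r; rewrite tnth_mktuple; exact: cvg_cst.
Qed.

End Gradient.

(** * Fenchel conjugate *)

Section Conjugate.
Context {R : realType} {d : nat}.
Implicit Types (x y : d.-tuple R) (phi : d.-tuple R -> R).

Lemma measurable_dotp (T : d.-tuple R -> d.-tuple R) : measurable_fun setT T ->
  measurable_fun setT (fun x => dotp x (T x)).
Proof.
move=> /measurable_fun_tnthP mT; apply: measurable_sum => i.
by apply: measurable_funM; [exact: measurable_tnth|exact: mT].
Qed.

Lemma measurable_dotpr x : measurable_fun setT (dotp x).
Proof.
apply: measurable_sum => i; apply: measurable_funM => //.
exact: measurable_tnth.
Qed.

Lemma measurable_sqnorm : measurable_fun setT (@sqnorm R d).
Proof. by apply: (@measurable_dotp id); exact: measurable_id. Qed.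

(* The supremum runs over rational points only, which keeps the conjugate
   measurable; continuity of [phi] makes it the supremum over all points. *)
Definition conj phi y : \bar R :=
  esups (fun n => (dotp (rat_point n) y - phi (rat_point n))%:E) 0.

Lemma measurable_conj phi : measurable_fun setT (conj phi).
Proof.
apply: measurable_fun_esups => n.
apply/measurable_EFinP; apply: measurable_funB => //.
exact: measurable_dotpr.
Qed.

Lemma conj_ge phi y n :
  ((dotp (rat_point n) y - phi (rat_point n))%:E <= conj phi y)%E.
Proof. by apply: ereal_sup_ubound; exists n. Qed.

Lemma subgradient_conj phi x y :
  (forall z, phi x + dotp y (tsub z x) <= phi z) ->
  (conj phi y <= (dotp x y - phi x)%:E)%E.
Proof.
move=> sub; apply: ge_ereal_sup => _ [n _ <-]; rewrite lee_fin.
have := sub (rat_point n); rewrite dotpC dotpBl; lra.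
Qed.

Lemma conj_fin_num phi x y :
  (forall z, phi x + dotp y (tsub z x) <= phi z) -> conj phi y \is a fin_num.
Proof.
move=> /subgradient_conj le; rewrite fin_numElt.
rewrite (le_lt_trans le) ?ltry// andbT.
exact: lt_le_trans (ltNyr _) (conj_ge phi y 0).
Qed.

Lemma fenchel phi x y : convex_fun phi -> conj phi y \is a fin_num ->
  dotp x y <= phi x + fine (conj phi y).
Proof.
move=> cphi fin.
(* The tilted function is convex, hence continuous, so a rational point near [x] has nearly the same
   value. *)
have cf : convex_fun (fun z => phi z - dotp z y).
  move=> u v t t01; have := cphi u v t t01.
  rewrite dotpDl !dotpZl; lra.
suff : - fine (conj phi y) <= phi x - dotp x y by lra.
apply/ler_addgt0Pr => e e0.
have [delta delta0 H] := convex_sup_continuous cf x e0.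
have [n /H] := rat_point_dense x delta0; rewrite ltr_norml.
have := conj_ge phi y n; rewrite -(fineK fin) lee_fin; lra.
Qed.

End Conjugate.

(** * Optimality of gradients of convex functions *)

Section Pushforward.
Context {R : realType} {d : nat}.
Variables (mu nu : {measure set (d.-tuple R) -> \bar R}).
Variable T : d.-tuple R -> d.-tuple R.
Hypotheses (mT : measurable_fun setT T) (Tmu : pushes T mu nu).
Local Open Scope ereal_scope.

Lemma pushes_integral (f : d.-tuple R -> \bar R) : measurable_fun setT f ->
  \int[mu]_x f (T x) = \int[nu]_x f x.
Proof.
suff H (g : d.-tuple R -> \bar R) : measurable_fun setT g ->
    (forall x, 0 <= g x) -> \int[mu]_x g (T x) = \int[nu]_x g x.
  move=> mf; rewrite -[fun x => f (T x)]/(f \o T) integralE [RHS]integralE.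
  rewrite funepos_comp funeneg_comp; congr (_ - _).
    apply: (H f^\+); first exact: measurable_funepos.
    exact: funepos_ge0.
  apply: (H f^\-); first exact: measurable_funeneg.
  exact: funeneg_ge0.
move=> mg g0; transitivity (\int[pushforward mu T]_x g x).
  by rewrite [RHS](ge0_integral_pushforward mT).
by apply: (eq_measure_integral nu) => A mA _; exact: Tmu.
Qed.

Lemma pushes_integrable (f : d.-tuple R -> \bar R) : measurable_fun setT f ->
  mu.-integrable setT (f \o T) <-> nu.-integrable setT f.
Proof.
move=> mf; have H : \int[mu]_x `|f (T x)| = \int[nu]_x `|f x|.
  by rewrite (pushes_integral (f := abse \o f))//; exact: measurableT_comp.
split=> /integrableP[mf' fi]; apply/integrableP; split => //.
- by rewrite -H.
- exact: measurableT_comp.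
- by rewrite H.
Qed.

End Pushforward.

(** * Integrals and conull sets *)

Section Conull.
Context {R : realType} {d : nat} (mu : {measure set (d.-tuple R) -> \bar R}).
Variable D : set (d.-tuple R).
Hypotheses (mD : measurable D) (muD : mu (~` D) = 0%E).

Lemma conull_integrable (f g : d.-tuple R -> R) :
  measurable_fun setT f -> (forall x, D x -> `|f x| <= `|g x|) ->
  mu.-integrable setT (EFin \o g) -> mu.-integrable setT (EFin \o f).
Proof.
move=> mf fg ig; have mD' := measurableC mD.
have mEf : measurable_fun setT (EFin \o f) by exact/measurable_EFinP.
apply/(negligible_integrable mD' measurableT mEf muD).
have := ig => /integrableP[mg _].
have {}ig := (negligible_integrable mD' measurableT mg muD).1 ig.
apply: le_integrable ig => //; first exact: measurableD.
- exact: measurable_funTS.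
- by move=> x [_ /= /contrapT Dx]; rewrite lee_fin; exact: fg.
Qed.

Lemma conull_ae (Q : d.-tuple R -> Prop) : (forall x, D x -> Q x) ->
  {ae mu, forall x, Q x}.
Proof.
move=> DQ; exists (~` D); split => //; first exact: measurableC.
by move=> x /= nQ Dx; exact/nQ/DQ.
Qed.

Lemma qcostE (T : d.-tuple R -> d.-tuple R) : measurable_fun setT T ->
  qcost mu T = (\int[mu]_x (sqnorm (tsub x (T x)))%:E)%E.
Proof.
move=> mT; have [mS muS] := support_conull mu.
rewrite /qcost [RHS](@ge0_negligible_integral _ _ _ _ _ (~` Defs.support mu))//.
- by rewrite setDE setCK setTI.
- exact: measurableC.
- apply/measurable_EFinP.
  apply: (measurableT_comp measurable_sqnorm); apply/measurable_fun_tnthP => i.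
  rewrite (_ : _ \o _ = fun x => tnth x i - tnth (T x) i); last first.
    by apply/funext => x /=; rewrite tnth_mktuple.
  apply: measurable_funB; first exact: measurable_tnth.
  by move/measurable_fun_tnthP : mT; exact.
- by move=> x _; rewrite lee_fin sqnorm_ge0.
Qed.

End Conull.

(** Follows from [|x - y|^2 >= 0] and [|x + y|^2 >= 0]; it turns second moments into integrability
    of the cross term. *)
Lemma dotp_le {R : realType} {d : nat} (x y : d.-tuple R) :
  `|dotp x y| <= sqnorm x + sqnorm y.
Proof.
have := sqnorm_ge0 (tsub x y); rewrite sqnorm_sub.
have := sqnorm_ge0 (tadd x y).
rewrite {1}/sqnorm dotpDl !(dotpC _ (tadd x y)) !dotpDl (dotpC y x) -/(sqnorm x).
rewrite -/(sqnorm y) ler_norml.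
have := sqnorm_ge0 x; have := sqnorm_ge0 y; lra.
Qed.

(* With [psi] the conjugate of [phi], put
   [w T x = |x|^2 - 2 phi x + |T x|^2 - 2 psi (T x)].  Its integral depends on
   [T] only through the image measure, and [|x - T x|^2 - w T x] is twice the
   Fenchel gap, which is nonnegative and vanishes iff [T x] is a subgradient of
   [phi] at [x]. *)
Section Brenier.
Context {R : realType} {d : nat}.
Variables (mu nu : {measure set (d.-tuple R) -> \bar R}).
Variables (phi : d.-tuple R -> R) (D : set (d.-tuple R)).
Variable T0 : d.-tuple R -> d.-tuple R.
Hypotheses (mu1 : mu setT = 1%E) (cphi : convex_fun phi).
Hypotheses (mD : measurable D) (muD : mu (~` D) = 0%E).
Hypotheses (mT0 : measurable_fun setT T0)
  (gradT0 : forall x, D x -> is_gradient phi x (T0 x)).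
Hypotheses (pT0 : pushes T0 mu nu).
Hypotheses (mu2 : finite_second_moment mu) (nu2 : finite_second_moment nu).

(** [fine] sends infinite values to 0, so [fenchel] applies to [psi] only where the conjugate is
    finite; [domT] below keeps track of this. *)
Let psi y := fine (conj phi y).
Let I (f : d.-tuple R -> R) := mu.-integrable setT (EFin \o f).

Let mphi : measurable_fun setT phi.
Proof. by apply: measurable_sup_continuous; exact: convex_sup_continuous. Qed.

Let mpsi : measurable_fun setT psi.
Proof.
apply: measurableT_comp; last exact: measurable_conj.
exact: fine_measurable.
Qed.

Let msq : measurable_fun setT (EFin \o @sqnorm R d).
Proof. by apply/measurable_EFinP; exact: measurable_sqnorm. Qed.

Let sub0 x : D x -> forall z, phi x + dotp (T0 x) (tsub z x) <= phi z.
Proof. by move=> Dx z; exact: gradient_subgradient (gradT0 Dx). Qed.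

Let fenchel0 x : D x -> dotp x (T0 x) = phi x + psi (T0 x).
Proof.
move=> Dx; have fin := conj_fin_num (sub0 Dx).
apply/eqP; rewrite eq_le fenchel//=.
have := subgradient_conj (sub0 Dx); rewrite -(fineK fin) lee_fin -/(psi _); lra.
Qed.

Let I_D f g : I f -> I g -> I (f \+ g).
Proof. by move=> If Ig; exact: (integrableD measurableT If Ig). Qed.

Let I_B f g : I f -> I g -> I (f \- g).
Proof. by move=> If Ig; exact: (integrableB measurableT If Ig). Qed.

Let I_Z k f : I f -> I (fun x => k * f x).
Proof. by move=> If; exact: (integrableZl measurableT k If). Qed.

Let I_cst k : I (cst k).
Proof.
apply/integrableP; split; first by apply/measurable_EFinP.
by rewrite (integral_cst mu measurableT `|k%:E|) mu1 mule1 ltry.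
Qed.

Let I_norm f : I f -> I (fun x => `|f x|).
Proof. by move=> /integrable_abse. Qed.

Let I_sq : I sqnorm.
Proof.
apply/integrableP; split; first exact: msq.
under eq_integral => x _ do rewrite gee0_abs ?lee_fin ?sqnorm_ge0//.
exact: mu2.
Qed.

Section Plan.
Variable T : d.-tuple R -> d.-tuple R.
Hypotheses (mT : measurable_fun setT T) (pT : pushes T mu nu).

Let I_sqT : I (fun x => sqnorm (T x)).
Proof.
apply: (pushes_integrable mT pT (f := EFin \o sqnorm) msq).2.
apply/integrableP; split; first exact: msq.
under eq_integral => x _ do rewrite gee0_abs ?lee_fin ?sqnorm_ge0//.
exact: nu2.
Qed.

Lemma plan_dotp_integrable : I (fun x => dotp x (T x)).
Proof.
apply: (conull_integrable mD muD _ _ (I_D I_sq I_sqT)); first exact: measurable_dotp.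
by move=> x _; rewrite (le_trans (dotp_le _ _))//= ler_norm.
Qed.

Lemma plan_cost_integrable : I (fun x => sqnorm (tsub x (T x))).
Proof.
have := I_B (I_D I_sq I_sqT) (I_Z 2 plan_dotp_integrable).
by congr (integrable _ _ _); apply/funext => x /=; rewrite sqnorm_sub.
Qed.

End Plan.

(** On [D], [phi] lies above its tangent at a fixed [x0], and below [dotp x (T0 x) + phi 0], because
    [fenchel] at the origin gives [psi (T0 x) >= - phi 0]. Both bounds are integrable. *)
Lemma potential_integrable : I phi.
Proof.
(* [D] has full mass 1, so it is not empty. *)
have [x0 Dx0] : exists x0, D x0.
  apply/not_existsP => D0; move: muD; rewrite (_ : ~` D = setT) ?mu1.
    by move/eqP; rewrite onee_eq0.
  by apply/seteqP; split=> x _ //; exact: D0.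
have Ig : I (dotp (T0 x0)).
  have := I_D (I_cst (sqnorm (T0 x0))) I_sq.
  apply: (conull_integrable mD muD); first exact: measurable_dotpr.
  by move=> x _; rewrite (le_trans (dotp_le _ _))//= ler_norm.
have Idot := plan_dotp_integrable mT0 pT0.
pose z0 : d.-tuple R := [tuple 0 | _ < d].
have := I_D (I_D (I_cst (`|phi x0| + `|dotp (T0 x0) x0| + `|phi z0|))
  (I_norm Ig)) (I_norm Idot).
apply: (conull_integrable mD muD) => // x Dx /=.
apply: le_trans (ler_norm _).
have lo := sub0 Dx0 x; rewrite dotpC dotpBl !(dotpC _ (T0 x0)) in lo.
have up : - phi z0 <= psi (T0 x).
  have := fenchel z0 cphi (conj_fin_num (sub0 Dx)).
  have -> : dotp z0 (T0 x) = 0.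
    by rewrite /dotp big1// => i _; rewrite tnth_mktuple mul0r.
  rewrite -/(psi _); lra.
have := fenchel0 Dx.
have := ler_norm (phi z0); have := ler_norm (- phi x0).
have := ler_norm (dotp (T0 x0) x0); have := ler_norm (- dotp (T0 x0) x).
have := ler_norm (dotp x (T0 x)); rewrite !normrN.
have := normr_ge0 (phi z0); have := normr_ge0 (phi x0).
have := normr_ge0 (dotp (T0 x0) x0); have := normr_ge0 (dotp (T0 x0) x).
have := normr_ge0 (dotp x (T0 x)); rewrite ler_norml; lra.
Qed.

(** On [D], [psi (T0 x)] is [dotp x (T0 x) - phi x]; integrability passes to [nu] through [T0], and
    from there to every competitor. *)
Let I_psi : nu.-integrable setT (EFin \o psi).
Proof.
have mEpsi : measurable_fun setT (EFin \o psi) by exact/measurable_EFinP.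
apply/(pushes_integrable mT0 pT0 mEpsi).
have := I_B (plan_dotp_integrable mT0 pT0) potential_integrable.
apply: (conull_integrable mD muD); first exact: measurableT_comp.
by move=> x Dx /=; rewrite fenchel0// addrC addKr.
Qed.

Let w T x := (sqnorm x - 2 * phi x) + (sqnorm (T x) - 2 * psi (T x)).

Section Gap.
Variable T : d.-tuple R -> d.-tuple R.
Hypotheses (mT : measurable_fun setT T) (pT : pushes T mu nu).

Let Iphi2 : I (fun x => sqnorm x - 2 * phi x).
Proof. exact: I_B I_sq (I_Z 2 potential_integrable). Qed.

Let k y := sqnorm y - 2 * psi y.

Let mk : measurable_fun setT (EFin \o k).
Proof.
apply/measurable_EFinP; apply: measurable_funB; first exact: measurable_sqnorm.
exact: measurable_funM.
Qed.

Let IkT : I (k \o T).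
Proof.
apply: (pushes_integrable mT pT mk).2.
have Inu : nu.-integrable setT (EFin \o @sqnorm R d).
  apply/integrableP; split; first exact: msq.
  under eq_integral => x _ do rewrite gee0_abs ?lee_fin ?sqnorm_ge0//.
  exact: nu2.
exact: (integrableB measurableT Inu (integrableZl measurableT 2 I_psi)).
Qed.

Lemma dual_integrable : I (w T).
Proof. exact: I_D Iphi2 IkT. Qed.

Lemma dual_integral : (\int[mu]_x (w T x)%:E =
  \int[mu]_x (sqnorm x - 2 * phi x)%:E +
  \int[nu]_x (sqnorm x - 2 * psi x)%:E)%E.
Proof.
rewrite (integralD_EFin measurableT Iphi2 IkT); congr (_ + _)%E.
exact: (pushes_integral mT pT mk).
Qed.

Definition domT := T @^-1` [set y | conj phi y \is a fin_num].

(** [T0] maps [D] into the domain of the conjugate, so that domain is conull for [nu], and every [T]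
    with the same image measure lands in it almost everywhere. *)
Lemma domT_conull : measurable domT /\ mu (~` domT) = 0%E.
Proof.
have mE : measurable [set y | conj phi y \is a fin_num].
  have := emeasurable_fin_num measurableT (@measurable_conj R d phi).
  by rewrite setTI.
split; first by have := mT measurableT mE; rewrite setTI.
have -> : mu (~` domT) = mu (T0 @^-1` ~` [set y | conj phi y \is a fin_num]).
  have mE' := measurableC mE.
  by rewrite (pT0 mE') -(pT mE').
apply/eqP; rewrite -measure_le0 -muD; apply: le_measure; rewrite ?inE.
- by have := mT0 measurableT (measurableC mE); rewrite setTI.
- exact: measurableC.
- by move=> x /= + Dx; apply; exact: conj_fin_num (sub0 Dx).
Qed.

Lemma gap_ge0 x : domT x -> 0 <= sqnorm (tsub x (T x)) - w T x.
Proof.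
move=> Ex; have := fenchel x cphi Ex; rewrite sqnorm_sub /w -/(psi _); lra.
Qed.

Lemma gap_eq0 x : D x -> domT x -> sqnorm (tsub x (T x)) - w T x = 0 ->
  T x = T0 x.
Proof.
move=> Dx Ex; rewrite sqnorm_sub /w => gap.
apply: (subgradient_gradient (gradT0 Dx)) => z.
have := fenchel z cphi Ex; rewrite -/(psi _) (dotpC (T x)) dotpBl; lra.
Qed.

(** The absolute value, harmless on [domT], serves both ends: the term is nonnegative for
    optimality, and its vanishing forces a zero gap almost everywhere for uniqueness. *)
Lemma gap_integral :
  (\int[mu]_x `|(sqnorm (tsub x (T x)) - w T x)%:E| + \int[mu]_x (w T x)%:E =
   qcost mu T)%E.
Proof.
have Ic := plan_cost_integrable mT pT; have Iw := dual_integrable.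
have Ig := I_B Ic Iw.
rewrite qcostE//.
have -> : (\int[mu]_x `|(sqnorm (tsub x (T x)) - w T x)%:E| =
    \int[mu]_x (sqnorm (tsub x (T x)) - w T x)%:E)%E.
  have mg : measurable_fun setT
      (fun x => (sqnorm (tsub x (T x)) - w T x)%:E).
    by case/integrableP : Ig.
  apply: ae_eq_integral => //; first exact: measurableT_comp.
  have [mE muE] := domT_conull.
  apply: (conull_ae mE muE) => x Ex _.
  by rewrite gee0_abs// lee_fin gap_ge0.
rewrite (integralB_EFin measurableT Ic Iw) subeK//.
exact: (integrable_fin_num measurableT Iw).
Qed.

End Gap.

Lemma gap0 x : D x -> sqnorm (tsub x (T0 x)) - w T0 x = 0.
Proof. by move=> Dx; rewrite sqnorm_sub /w fenchel0//; ring. Qed.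

Lemma brenier_cost : qcost mu T0 = (\int[mu]_x (w T0 x)%:E)%E.
Proof.
rewrite -gap_integral// (ae_eq_integral (cst 0%E)) ?integral0 ?add0e//.
  have := I_B (plan_cost_integrable mT0 pT0) (dual_integrable mT0 pT0).
  by case/integrableP => mg _; exact: measurableT_comp.
by apply: (conull_ae mD muD) => x Dx _; rewrite gap0//= normr0.
Qed.

Lemma brenier_optimal T : measurable_fun setT T -> pushes T mu nu ->
  (qcost mu T0 <= qcost mu T)%E.
Proof.
move=> mT pT; rewrite brenier_cost -(gap_integral mT pT) !dual_integral//.
by rewrite leeDr// integral_ge0.
Qed.

Lemma brenier_unique T : measurable_fun setT T -> pushes T mu nu ->
  qcost mu T = qcost mu T0 -> {ae mu, forall x, T x = T0 x}.
Proof.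
move=> mT pT; rewrite brenier_cost -(gap_integral mT pT) !dual_integral//.
rewrite -(dual_integral mT pT).
have Iw := dual_integrable mT pT.
have Ig := I_B (plan_cost_integrable mT pT) Iw.
have mg : measurable_fun setT (fun x => (sqnorm (tsub x (T x)) - w T x)%:E).
  by case/integrableP : Ig.
(* Cancelling the finite dual integral leaves a zero integral of the absolute gap. *)
move=> /(congr1 (fun z => z - \int[mu]_x (w T x)%:E)%E).
have fw := integrable_fin_num measurableT Iw.
rewrite addeK// subee// => /(ae_eq_integral_abs mu measurableT mg).
have [mE muE] := domT_conull mT pT.
have aD := conull_ae mD muD (fun x (Dx : D x) => Dx).
have aE := conull_ae mE muE (fun x (Ex : domT T x) => Ex).
apply: filterS3 aD aE => x Dx Ex /(_ Logic.I)/= [].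
exact: gap_eq0.
Qed.

End Brenier.

(** * Conditional laws of the model *)

Section Conditional.
Context {R : realType} {dO : measure_display} {Omega : measurableType dO}.
Variable P : probability Omega R.

Lemma ae_le_measure (A B : set Omega) : measurable A -> measurable B ->
  {ae P, forall w, A w -> B w} -> (P A <= P B)%E.
Proof.
move=> mA mB [N [mN N0 AB]]; apply: (@le_trans _ _ (P (B `|` N))).
  apply: le_measure; rewrite ?inE//; first exact: measurableU.
  move=> w Aw; have [Bw|nBw] := pselect (B w); first by left.
  by right; apply: AB => /= /(_ Aw).
apply: le_trans (measureU2 _ mB mN) _.
by rewrite [X in (_ + X)%E]N0 adde0.
Qed.

Lemma ae_eq_measure (A B : set Omega) : measurable A -> measurable B ->
  {ae P, forall w, A w <-> B w} -> P A = P B.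
Proof.
move=> mA mB AB; apply/eqP; rewrite eq_le.
by apply/andP; split; apply: ae_le_measure => //; apply: filterS AB => w [].
Qed.

(** [cond_law] is a bare set function; as a scaled pushforward of a restriction of [P] it acquires
    the measure structure used above. *)
Lemma cond_law_measure (d : nat) (X : Omega -> d.-tuple R) (S : Omega -> R)
    (s : R) : measurable_fun setT X -> measurable (S @^-1` [set s]) ->
  exists mu : {measure set (d.-tuple R) -> \bar R},
    cond_law P X S s = mu :> (set (d.-tuple R) -> \bar R).
Proof.
move=> mX mS.
have c0 : 0 <= (fine (P (S @^-1` [set s])))^-1 by rewrite invr_ge0 fine_ge0.
unshelve eexists (mscale (NngNum c0) (pushforward (mrestr P mS) X)) => //.
by apply/funext => A; rewrite /cond_law /mscale/= /pushforward /mrestr muleC.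
Qed.

End Conditional.

Section Splice.
Context {R : realType} {m : nat}.
Implicit Types (J : {set 'I_m}) (u : m.-tuple R).

(* The domain of exogenous vectors constrains every coordinate, so an event
   about the coordinates in [J] is expressed through [splice], which freezes
   the other ones at those of an admissible [u0]. *)
Definition splice J u0 u : m.-tuple R :=
  [tuple if j \in J then tnth u j else tnth u0 j | j < m].

Lemma measurable_splice J u0 : measurable_fun setT (splice J u0).
Proof.
apply/measurable_fun_tnthP => j.
rewrite (_ : _ \o _ =
  fun u => if j \in J then tnth u j else tnth u0 j); last first.
  by apply/funext => u /=; rewrite tnth_mktuple.
by case: (j \in J); [exact: measurable_tnth|exact: measurable_cst].
Qed.

Lemma splice_depends_only_on J u0 (A : set (m.-tuple R)) :
  depends_only_on J (splice J u0 @^-1` A).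
Proof.
move=> u u' uu'; rewrite /preimage/=.
suff -> : splice J u0 u = splice J u0 u' by [].
by apply: eq_from_tnth => j; rewrite !tnth_mktuple; case: ifP => // /uu'.
Qed.

End Splice.

(** * The law of X given S *)

Section Model.
Context {R : realType} {d m : nat} (M : SCM R d m).
Hypothesis wfM : wf_SCM M.

Lemma measurable_Udom : measurable (Udom M).
Proof.
case: wfM => _ mU _ _ _.
have -> : Udom M = \bigcap_(j : 'I_m) [set u | Usp M j (tnth u j)].
  by apply/seteqP; split=> u H j => [_|]; exact: H.
apply: fin_bigcap_measurable => // j _.
by have := measurable_tnth j measurableT (mU j); rewrite setTI.
Qed.

Lemma measurable_Vdom : measurable (Vdom M).
Proof.
case: wfM => mV _ _ _ _.
have -> : Vdom M = \bigcap_(i : 'I_d.+1) [set v | Vsp M i (tnth v i)].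
  by apply/seteqP; split=> v H i => [_|]; exact: H.
apply: fin_bigcap_measurable => // i _.
by have := measurable_tnth i measurableT (mV i); rewrite setTI.
Qed.

Lemma Udom_splice J u0 u : Udom M u0 -> Udom M u -> Udom M (splice J u0 u).
Proof. by move=> Uu0 Uu j; rewrite tnth_mktuple; case: ifP. Qed.

Lemma measurable_Xpart : measurable_fun setT (@Xpart R d).
Proof.
apply/measurable_fun_tnthP => i.
rewrite (_ : _ \o _ = fun v : d.+1.-tuple R =>
  tnth v (widen_ord (leqnSn d) i)); first exact: measurable_tnth.
by apply/funext => v /=; rewrite tnth_mktuple.
Qed.

(** The chosen preimage may differ from [u], but injectivity makes both agree on [JX M], which is
    all that [F s'] sees. *)
Lemma cf_opE (F : R -> m.-tuple R -> d.-tuple R) (s s' : R) u :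
  (forall u v, (forall j, j \in JX M -> tnth u j = tnth v j) ->
     F s' u = F s' v) ->
  inj_on_UX M (F s) -> Udom M u -> cf_op M F s s' (F s u) = F s' u.
Proof.
move=> FJX injF Uu; apply: FJX.
have [] := @xgetPex _ [tuple 0 | _ < m] [set v | Udom M v /\ F s v = F s u].
  by exists u.
by move=> Uv Fv; exact: injF.
Qed.

Section Law.
Context {dO : measure_display} {Omega : measurableType dO}.
Variables (P : probability Omega R).
Variables (U : Omega -> m.-tuple R) (V : Omega -> (d.+1).-tuple R).
Variables (F : R -> m.-tuple R -> d.-tuple R) (s : R).
Hypotheses (exoU : exo_vector M U) (acM : acyclic M).
Hypotheses (solV : is_solution P M U V) (reM : RE P M U).
Hypothesis Ps : (0 < P [set w | Spart (V w) = s])%E.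
Hypothesis FJX : forall u u',
  (forall j, j \in JX M -> tnth u j = tnth u' j) -> F s u = F s u'.
Hypothesis mF : measurable_fun (Udom M) (F s).
Hypothesis XF : {ae P, forall w, Xpart (V w) = F (Spart (V w)) (U w)}.

(** (RE) excludes the components of X and acyclicity excludes a loop at S. *)
Lemma Endo_S k : k \notin Endo M ord_max.
Proof.
have [_ XS] := reM; apply/negP => kS.
have [kd|dk] := ltnP k d.
  have /negP := XS (Ordinal kd); apply.
  by have -> : widen_ord (leqnSn d) (Ordinal kd) = k by exact: val_inj.
have kE : k = ord_max.
  by apply: val_inj; apply/eqP; rewrite eqn_leq dk -ltnS ltn_ord.
have := acM (x := inl ord_max) (p := [:: inl ord_max]).
by rewrite /= -{1}kE kS => /(_ isT erefl).
Qed.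

Lemma measurable_F_U (A : set (d.-tuple R)) : measurable A ->
  measurable [set w | A (F s (U w))].
Proof.
move=> mA; have [mU UU] := exoU.
have := mU measurableT _ (mF measurable_Udom mA); rewrite setTI.
congr measurable; apply/seteqP; split=> w /=; first by case.
by split => //; exact: UU.
Qed.

Lemma measurable_S_eq : measurable [set w | Spart (V w) = s].
Proof.
have [mV _ _] := solV.
have := measurableT_comp (@measurable_tnth _ R d.+1 ord_max) mV.
move=> /(_ measurableT [set s]); rewrite setTI; apply.
exact: measurable_set1.
Qed.

Lemma cond_law_F (A : set (d.-tuple R)) : measurable A ->
  cond_law P (Xpart \o V) (Spart \o V) s A = P [set w | A (F s (U w))].
Proof.
move=> mA; have [mU UU] := exoU; have [mV VV Veq] := solV.
have [_ _ _ GJ mG] := wfM; have mS := measurable_S_eq.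
have [w0 _] : exists w, [set w | Spart (V w) = s] w.
  apply/set0P/eqP => S0; move: Ps; rewrite S0.
  by rewrite [X in (_ < X)%E](measure0 P) ltxx.
pose spS := splice (JS M) (U w0); pose spX := splice (JX M) (U w0).
(* [C] and [B] express S = s and [F s u] in [A] through the coordinates in [JS M] and [JX M] alone;
   meeting [Udom M] is what makes them measurable. *)
pose C := spS @^-1` (Udom M `&` [set u | G M ord_max (V w0, u) = s]).
pose B := spX @^-1` (Udom M `&` F s @^-1` A).
have mC : measurable C.
  rewrite -[C]setTI; apply: (measurable_splice (JS M) (U w0)) => //.
  have mVU := measurableX measurable_Vdom measurable_Udom.
  have := pair1_measurable (V w0) measurableT (mG ord_max mVU _ (measurable_set1 s)).
  rewrite setTI; congr measurable; apply/seteqP; split=> u /=.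
    by case=> -[].
  by case=> Uu Gs; split => //; split => //=; exact: VV.
have mB : measurable B.
  rewrite -[B]setTI; apply: (measurable_splice (JX M) (U w0)) => //.
  exact: mF measurable_Udom _ mA.
have mUC : measurable (U @^-1` C) by rewrite -[X in measurable X]setTI; exact: mU.
have mUB : measurable (U @^-1` B) by rewrite -[X in measurable X]setTI; exact: mU.
have CE : {ae P, forall w, C (U w) <-> Spart (V w) = s}.
  apply: filterS (Veq ord_max) => w; rewrite /C /Spart /= => ->.
  have <- : G M ord_max (V w0, spS (U w)) = G M ord_max (V w, U w).
    apply: GJ => [k|j jS]; first by rewrite (negbTE (Endo_S k)).
    by rewrite tnth_mktuple jS.
  by split=> [[]//|]; split => //; exact: Udom_splice.
have BE w : B (U w) <-> A (F s (U w)).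
  have FE : F s (spX (U w)) = F s (U w).
    by apply: FJX => j jX; rewrite tnth_mktuple jX.
  rewrite /B /= FE; split=> [[]//|]; split => //; exact: Udom_splice.
have XSE : P ((Xpart \o V) @^-1` A `&` (Spart \o V) @^-1` [set s]) =
    P (U @^-1` C `&` U @^-1` B).
  apply: ae_eq_measure.
  - apply: measurableI => //; rewrite -[X in measurable X]setTI.
    exact: (measurableT_comp measurable_Xpart mV).
  - exact: measurableI.
  - apply: filterS2 XF CE => w Xw Cw /=; rewrite Xw; split.
      by move=> [AF Sw]; split; [exact/Cw|apply/BE; rewrite -Sw].
    by move=> [/Cw Sw /BE AF]; rewrite Sw.
rewrite /cond_law XSE reM.1//; last first.
- exact: splice_depends_only_on.
- exact: splice_depends_only_on.
rewrite (ae_eq_measure mUC mS CE).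
have -> : P (U @^-1` B) = P [set w | A (F s (U w))].
  by congr (P _); apply/seteqP; split=> w /BE.
have fS : P [set w | Spart (V w) = s] \is a fin_num by exact: fin_num_measure.
rewrite [P ((Spart \o V) @^-1` _)](_ : _ = P [set w | Spart (V w) = s])//.
rewrite muleAC -{1}(fineK fS) -EFinM mulfV ?mul1e//.
by rewrite gt_eqF// fine_gt0// Ps ltey_eq fS.
Qed.

End Law.

End Model.

Theorem theorem1 (R : realType) (dO : measure_display) (Omega : measurableType dO)
    (P : probability Omega R) (d m : nat) (M : SCM R d m)
    (U : Omega -> m.-tuple R) (V : Omega -> (d.+1).-tuple R)
    (Sset : seq R) (F : R -> m.-tuple R -> d.-tuple R)
    (phi : d.-tuple R -> R) (s s' : R) :
  (* the model M = <U, G> *)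
  wf_SCM M -> exo_vector M U ->
  (* Assumption (A) *)
  acyclic M ->
  (* V = (X, S) is the solution of M, S takes values in the finite set Sset,
     each value having positive probability *)
  is_solution P M U V ->
  (forall w, Spart (V w) \in Sset) ->
  (forall s0, s0 \in Sset -> (0 < P [set w | Spart (V w) = s0])%E) ->
  (* Assumption (RE) *)
  RE P M U ->
  (* F: X = F(S, U_X) a.s. and X_{S=s0} = F(s0, U_X) a.s., F measurable *)
  (forall s0 u u', (forall j, j \in JX M -> tnth u j = tnth u' j) ->
     F s0 u = F s0 u') ->
  (forall s0, s0 \in Sset -> measurable_fun (Udom M) (F s0)) ->
  {ae P, forall w, Xpart (V w) = F (Spart (V w)) (U w)} ->
  (forall s0, s0 \in Sset -> forall W : Omega -> (d.+1).-tuple R,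
     is_solution P (do_S M s0) U W ->
     {ae P, forall w, Xpart (W w) = F s0 (U w)}) ->
  (* Assumption (I) *)
  (forall s0, s0 \in Sset -> inj_on_UX M (F s0)) ->
  (* the mu_s are absolutely continuous and have finite second moments *)
  (forall s0, s0 \in Sset ->
     abs_cont_leb (cond_law P (Xpart \o V) (Spart \o V) s0)) ->
  (forall s0, s0 \in Sset ->
     finite_second_moment (cond_law P (Xpart \o V) (Spart \o V) s0)) ->
  s \in Sset -> s' \in Sset ->
  (* T*_<s'|s> = grad phi, mu_s-a.e., with phi convex *)
  convex_fun phi ->
  {ae cond_law P (Xpart \o V) (Spart \o V) s,
     forall x, is_gradient phi x (cf_op M F s s' x)} ->
  (* conclusion: T*_<s'|s> is (mu_s-a.e.) the a.e.-unique optimal map *)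
  let mu_s := cond_law P (Xpart \o V) (Spart \o V) s in
  let mu_s' := cond_law P (Xpart \o V) (Spart \o V) s' in
  exists T0 : d.-tuple R -> d.-tuple R,
    [/\ measurable_fun setT T0,
        {ae mu_s, forall x, cf_op M F s s' x = T0 x},
        pushes T0 mu_s mu_s',
        (forall T : d.-tuple R -> d.-tuple R, measurable_fun setT T ->
           pushes T mu_s mu_s' -> (qcost mu_s T0 <= qcost mu_s T)%E) &
        (forall T : d.-tuple R -> d.-tuple R, measurable_fun setT T ->
           pushes T mu_s mu_s' -> qcost mu_s T = qcost mu_s T0 ->
           {ae mu_s, forall x, T x = T0 x})].
Proof.
move=> wfM exoU acM solV _ Ppos reM FJX mF XF _ injF _ fsm sS s'S cphi gphi.
have mV : measurable_fun setT V by case: solV.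
have mX := measurableT_comp (@measurable_Xpart R d) mV.
have mS t := measurable_S_eq t solV.
have law t (tS : t \in Sset) := cond_law_F wfM exoU acM solV reM (Ppos t tS)
  (FJX t) (mF t tS) XF.
have [mu muE] := cond_law_measure P mX (mS s).
have [nu nuE] := cond_law_measure P mX (mS s').
have lawmu := law s sS; have lawnu := law s' s'S.
have := fsm s sS; have := fsm s' s'S.
rewrite /= muE nuE in gphi lawmu lawnu *; move=> nu2 mu2.
have UU w : Udom M (U w) by case: exoU.
have [N [mN muN NG]] := gphi.
(* A measurable null cover [N] is removed, since the set of points where the gradient property holds
   need not itself be measurable. *)
pose D := ~` N; have mD : measurable D by exact: measurableC.
have muD : mu (~` D) = 0%E by rewrite setCK.
have gD x : D x -> is_gradient phi x (cf_op M F s s' x).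
  by move=> Dx; apply: contrapT => ng; exact/Dx/NG.
pose T0 := patch (cst [tuple 0 | _ < d]) D (cf_op M F s s').
have T0E x : D x -> T0 x = cf_op M F s s' x by move=> Dx; rewrite /T0 patchT ?inE.
have mT0 : measurable_fun setT T0 by exact: measurable_gradient gD.
have gT0 x : D x -> is_gradient phi x (T0 x).
  by move=> Dx; rewrite T0E//; exact: gD.
have mFU t (tS : t \in Sset) A (mA : measurable A) :=
  measurable_F_U wfM exoU (mF t tS) mA.
have pT0 : pushes T0 mu nu.
  move=> A mA; have mTA : measurable (T0 @^-1` A).
    by rewrite -[X in measurable X]setTI; exact: mT0.
  rewrite lawmu// lawnu//; apply: ae_eq_measure; [exact: mFU..|].
  (* This event has probability [mu N = 0]; off it, [T0] sends [F s (U w)] to [F s' (U w)] by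
     [cf_opE]. *)
  exists [set w | N (F s (U w))]; split; first exact: mFU.
    by rewrite -lawmu.
  move=> w /=; apply: contra_notP => nN.
  rewrite /preimage/= T0E// (cf_opE _ (injF s sS))//; exact: FJX.
have mu1 : mu setT = 1%E.
  rewrite lawmu// -(@probability_setT _ _ _ P).
  by congr (P _); apply/seteqP.
exists T0; split => //.
- by apply: (conull_ae mD muD) => x /T0E.
- exact: brenier_optimal mu1 cphi mD muD mT0 gT0 pT0 mu2 nu2.
- exact: brenier_unique mu1 cphi mD muD mT0 gT0 pT0 mu2 nu2.
Qed.
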